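(* Let $P$ be a poset all of whose principal order ideals are finite, let $\phi:\phi(0)<\phi(1)<\cdots<\phi(n-1)$ be a finite nonempty chain in $P$, and let $L=\mathrm{Tam}(P,\phi)$. Then the lattice $L$ is join-semidistributive. If, additionally, $P$ has a minimum element, then $L$ is semidistributive if and only if each element of $I_P(\phi(n-1))$ is comparable to all the elements of the chain $\phi(1)<\phi(2)<\cdots<\phi(n-1)$.
   Context: For $x\in P$, $I_P(x)=\{y\in P\mid y\le x\}$. For $0\le i<n$ let $\mathcal{C}_i=I_P(\phi(i))\times\{i\}$, ordered by $(x,i)\le (y,i)$ iff $x\le y$ in $P$, and let $\mathcal{C}_P^{\phi}=\bigsqcup_{0\le i<n}\mathcal{C}_i$ be the disjoint union of these posets (elements of different components are incomparable). An order filter (up-closed subset) $T$ of $\mathcal{C}_P^{\phi}$ is torclosed if for all $0\le i<j<n$ and all $x$, $(x,i)\in T$ and $(\phi(i+1),j)\in T$ imply $(x,j)\in T$. $\mathrm{Tam}(P,\phi)$ is the set of torclosed subsets of $\mathcal{C}_P^{\phi}$ ordered by inclusion; it is a finite lattice whose meet is intersection. A lattice $L$ is join-semidistributive if for all $x,y,z\in L$, $x\vee y=x\vee z$ implies $x\vee(y\wedge z)=x\vee y$; meet-semidistributive is the dual notion; semidistributive means both. *)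

(* Defs.v *)
From HB Require Import structures.
From mathcomp Require Import all_boot all_order.
From mathcomp Require Import boolp classical_sets cardinality.
Set Implicit Arguments.
Unset Strict Implicit.
Unset Printing Implicit Defensive.
Import Order.TTheory.
Local Open Scope classical_set_scope.
Local Open Scope order_scope.

Definition principal_ideal d (P : porderType d) (x : P) : set P :=
  [set y | y <= x].

Definition order_filter d (P : porderType d) (T : set P) : Prop :=
  forall x y : P, x <= y -> T x -> T y.

Definition join_semidistributive d (L : latticeType d) : Prop :=
  forall x y z : L, x `|` y = x `|` z -> x `|` (y `&` z) = x `|` y.

Definition meet_semidistributive d (L : latticeType d) : Prop :=
  forall x y z : L, x `&` y = x `&` z -> x `&` (y `|` z) = x `&` y.

Definition semidistributive d (L : latticeType d) : Prop :=
  join_semidistributive L /\ meet_semidistributive L.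

Fact comp_display : Order.disp_t. Proof. exact: (Order.Disp tt tt). Qed.
Fact tam_display : Order.disp_t. Proof. exact: (Order.Disp tt tt). Qed.

Section Tam.
Variables (d : Order.disp_t) (P : porderType d) (n : nat) (phi : 'I_n -> P).

(* The pairs (x, i) with x in the principal ideal of phi i.  The order is not
   the product order on P * 'I_n: distinct second components are
   incomparable. *)
Record tcomp := TComp { comp_pair : P * 'I_n;
                      _ : comp_pair.1 <= phi comp_pair.2 }.

HB.instance Definition _ := [isSub for comp_pair].
HB.instance Definition _ := [Choice of tcomp by <:].

Definition comp_pt (a : tcomp) : P := (comp_pair a).1.
Definition comp_idx (a : tcomp) : 'I_n := (comp_pair a).2.

Definition comp_le : rel tcomp :=
  fun a b => (comp_idx a == comp_idx b) && (comp_pt a <= comp_pt b).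

Lemma comp_le_refl : reflexive comp_le.
Proof. by move=> a; rewrite /comp_le eqxx lexx. Qed.

Lemma comp_le_anti : antisymmetric comp_le.
Proof.
move=> a b /andP[/andP[/eqP ei ab] /andP[_ ba]]; apply: val_inj.
have ep : comp_pt a = comp_pt b by apply/le_anti; rewrite ab ba.
move: ei ep; rewrite /comp_pt /comp_idx /=.
by case: (comp_pair a) (comp_pair b) => [? ?] [? ?] /= -> ->.
Qed.

Lemma comp_le_trans : transitive comp_le.
Proof.
move=> b a c /andP[/eqP eab ab] /andP[/eqP ebc bc].
by rewrite /comp_le eab ebc eqxx (le_trans ab bc).
Qed.

HB.instance Definition _ := Order.Le_isPOrder.Build comp_display tcomp
  comp_le_refl comp_le_anti comp_le_trans.

(* Here a = (x, i), b = (phi (i + 1), j) and c = (x, j).  Since i < j < n, the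
   cyclic successor [ordS i] is i + 1; when phi is increasing, b and c exist
   for all such i, j and x. *)
Definition torclosed (T : set tcomp) : Prop :=
  order_filter T /\
  forall a b c : tcomp,
    (comp_idx a < comp_idx b)%N ->
    comp_pt b = phi (ordS (comp_idx a)) ->
    comp_pt c = comp_pt a -> comp_idx c = comp_idx b ->
    T a -> T b -> T c.

(* [set tcomp] is ordered by inclusion, and Tam inherits that order. *)
Record Tam := MkTam { tam_set : set tcomp; _ : `[< torclosed tam_set >] }.

HB.instance Definition _ := [isSub for tam_set].
HB.instance Definition _ := [Choice of Tam by <:].
HB.instance Definition _ := [SubChoice_isSubPOrder of Tam by <:
  with tam_display].

Lemma tam_leP (X Y : Tam) : X <= Y <-> tam_set X `<=` tam_set Y.
Proof. by rewrite -subsetEset -Order.le_val. Qed.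

Lemma tam_torclosed (X : Tam) : torclosed (tam_set X).
Proof. by case: X => T /= /asboolP. Qed.

Lemma torclosed_bigcap (F : set (set tcomp)) :
  F `<=` torclosed -> torclosed (\bigcap_(T in F) T).
Proof.
move=> FT; split=> [a b ab Fa T FT'|a b c ij eb ec1 ec2 Fa Fb T FT'].
  exact: (FT T FT').1 ab (Fa T FT').
exact: (FT T FT').2 ij eb ec1 ec2 (Fa T FT') (Fb T FT').
Qed.

Lemma tam_meet_subproof (X Y : Tam) :
  `[< torclosed (tam_set X `&` tam_set Y)%classic >].
Proof.
apply/asboolP.
have [[fX tX] [fY tY]] := (tam_torclosed X, tam_torclosed Y).
split=> [a b ab [Xa Ya]|a b c ij eb ec1 ec2 [Xa Ya] [Xb Yb]].
  by split; [exact: fX ab Xa | exact: fY ab Ya].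
by split; [exact: tX ij eb ec1 ec2 Xa Xb | exact: tY ij eb ec1 ec2 Ya Yb].
Qed.

Definition tam_meet (X Y : Tam) : Tam := MkTam (tam_meet_subproof X Y).

Definition torclosure (A : set tcomp) : set tcomp :=
  \bigcap_(T in [set T | torclosed T /\ A `<=` T]) T.

Lemma tam_join_subproof (X Y : Tam) :
  `[< torclosed (torclosure (tam_set X `|` tam_set Y)%classic) >].
Proof. by apply/asboolP; apply: torclosed_bigcap => T []. Qed.

Definition tam_join (X Y : Tam) : Tam := MkTam (tam_join_subproof X Y).

Lemma tam_meetP (X Y Z : Tam) : (X <= tam_meet Y Z) = (X <= Y) && (X <= Z).
Proof.
apply/idP/andP => [/tam_leP XYZ|[/tam_leP XY /tam_leP XZ]].
  by split; apply/tam_leP => a /XYZ[].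
by apply/tam_leP => a Xa; split; [exact: XY | exact: XZ].
Qed.

Lemma tam_joinP (X Y Z : Tam) : (tam_join X Y <= Z) = (X <= Z) && (Y <= Z).
Proof.
apply/idP/andP => [/tam_leP XYZ|[/tam_leP XZ /tam_leP YZ]].
  by split; apply/tam_leP => a Xa; apply: XYZ => T [_]; apply; [left|right].
apply/tam_leP => a; apply; split; first exact: tam_torclosed.
by move=> b [/XZ|/YZ].
Qed.

HB.instance Definition _ :=
  Order.POrder_MeetJoin_isLattice.Build tam_display Tam tam_meetP tam_joinP.

End Tam.

(* Main.v *)
Require Import Defs.
From mathcomp Require Import all_boot all_order.
From mathcomp Require Import boolp classical_sets cardinality.
Set Implicit Arguments.
Unset Strict Implicit.
Unset Printing Implicit Defensive.
Import Order.TTheory.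
Local Open Scope order_scope.

(* Join-semidistributivity: if W < T are torclosed, T has an element e outside W
   such that removing from T everything below e leaves a torclosed set
   containing W.  Hence every U with W \/ U = T contains e; for T = X \/ Y =
   X \/ Z and W = X \/ (Y /\ Z) this would put e in Y /\ Z.

   Meet-semidistributivity: if the points below the top of the chain are
   comparable to phi(1), phi(2), ..., then every element (x, j) of Y \/ Z is
   obtained from (x', i_1), (phi(i_1 + 1), i_2), ..., (phi(i_r + 1), j) in the
   union of Y and Z, with x' <= x <= phi(i_1 + 1); if (x, j) is in X, so are all
   the (phi(i_s + 1), j), and these lie in X /\ Y = X /\ Z by induction on the
   length.  Conversely, if y is incomparable to phi(k), let X and Z be generated
   by (y, max) and (phi(k), max), and let Y be the union of component k - 1 with
   X /\ Z.  Then X /\ Y = X /\ Z does not contain (y, max), but Y \/ Z contains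
   (m, k - 1) and (phi(k), max), hence (m, max) and (y, max). *)

Section Tamari.
Context {d : Order.disp_t} {P : porderType d} {n : nat} {phi : 'I_n -> P}.
Implicit Types (a b c e : tcomp phi) (X Y Z T U W : Tam phi).

Lemma comp_ptP a : comp_pt a <= phi (comp_idx a).
Proof. by case: a. Qed.

Lemma comp_leP a b :
  a <= b <-> comp_idx a = comp_idx b /\ comp_pt a <= comp_pt b.
Proof. by split=> [/andP[/eqP]|[/eqP ab ?]] //; apply/andP. Qed.

Lemma tam_filter X a b : a <= b -> tam_set X a -> tam_set X b.
Proof. exact: (tam_torclosed X).1. Qed.

Lemma tam_tor X a b c :
  (comp_idx a < comp_idx b)%N -> comp_pt b = phi (ordS (comp_idx a)) ->
  comp_pt c = comp_pt a -> comp_idx c = comp_idx b ->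
  tam_set X a -> tam_set X b -> tam_set X c.
Proof. exact: (tam_torclosed X).2. Qed.

Lemma tam_meetE X Y : tam_set (X `&` Y) = (tam_set X `&` tam_set Y)%classic.
Proof. by []. Qed.

Lemma tam_eqP X Y : (forall a, tam_set X a <-> tam_set Y a) -> X = Y.
Proof. by move=> XY; apply: le_anti; apply/andP; split; apply/tam_leP => a /XY. Qed.

Lemma tam_join_sub (S : set (tcomp phi)) X Y : torclosed S ->
  (tam_set X `<=` S)%classic -> (tam_set Y `<=` S)%classic ->
  (tam_set (X `|` Y)%O `<=` S)%classic.
Proof. by move=> tS XS YS a; apply; split=> // b [/XS|/YS]. Qed.

(** [ordS] is cyclic; a larger index [j] keeps [i] off the last one, where it would wrap to [0]. *)
Lemma val_ordS (i j : 'I_n) : (i < j)%N -> ordS i = i.+1 :> nat.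
Proof. by move=> ij; rewrite /= modn_small // (leq_ltn_trans ij). Qed.

Hypothesis hphi : forall i j : 'I_n, (i < j)%N -> phi i < phi j.

Lemma chain_homo (i j : 'I_n) : (i <= j)%N -> phi i <= phi j.
Proof.
by rewrite leq_eqVlt => /predU1P[/val_inj -> //|/hphi]; exact: ltW.
Qed.

Lemma chain_ordS_le (i j : 'I_n) : (i < j)%N -> phi (ordS i) <= phi j.
Proof. by move=> ij; apply: chain_homo; rewrite (val_ordS ij). Qed.

Lemma chain_le_ordS (i j : 'I_n) : (i < j)%N -> phi i <= phi (ordS i).
Proof. by move=> ij; apply: chain_homo; rewrite (val_ordS ij). Qed.

(* The component of e is the first one where T and W differ, and e dominates the
   points phi(i + 1) of T \ W in it: no point below e is then derived from the
   points of T that are not below e. *)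
Lemma exists_peak W T : ~ T <= W -> exists e, [/\ tam_set T e, ~ tam_set W e,
    forall a, (comp_idx a < comp_idx e)%N -> tam_set T a -> tam_set W a &
    forall b (i : 'I_n), comp_idx b = comp_idx e -> (i < comp_idx e)%N ->
      comp_pt b = phi (ordS i) -> tam_set T b -> ~ tam_set W b -> b <= e].
Proof.
move=> nTW.
have [a [Ta nWa]] : exists a, tam_set T a /\ ~ tam_set W a.
  apply: contrapT => nex; apply: nTW; apply/tam_leP => a Ta.
  by apply: contrapT => nWa; apply: nex; exists a.
pose bad j := `[< exists a, [/\ tam_set T a, ~ tam_set W a &
                                comp_idx a = j :> nat] >].
have exbad : exists j, bad j by exists (comp_idx a); apply/asboolP; exists a.
have [j /asboolP[{nWa}{Ta}{}a [Ta nWa aj]] minj] := ex_minnP exbad.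
have below c : (comp_idx c < j)%N -> tam_set T c -> tam_set W c.
  move=> cj Tc; apply: contrapT => nWc; move: cj; rewrite ltnNge => /negP; apply.
  by apply: minj; apply/asboolP; exists c.
pose chainbad k := `[< exists b (i : 'I_n), [/\ tam_set T b, ~ tam_set W b,
  comp_idx b = j :> nat, (i < j)%N & comp_pt b = phi (ordS i) /\ i = k :> nat] >].
(* With no such chain point, the last clause is vacuous and [a] serves; otherwise the largest [k]
   gives the highest one. *)
have [exk|nexk] := pselect (exists k, chainbad k); last first.
  exists a; split=> //; first by rewrite aj.
  move=> b i bidx ij bpt Tb nWb; exfalso; apply: nexk; exists i.
  by apply/asboolP; exists b, i; rewrite bidx -aj.
have ubk k : chainbad k -> (k <= j)%N.
  by move=> /asboolP[b [i [_ _ _ ij [_ <-]]]]; exact: ltnW.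
have [k /asboolP[e [i [Te nWe ej ij [ept ik]]]] maxk] := ex_maxnP exk ubk.
exists e; split=> //; first by rewrite ej.
have ije : (i < comp_idx e)%N by rewrite ej.
move=> b i' bidx i'j bpt Tb nWb.
apply/comp_leP; split=> //; rewrite bpt ept; apply: chain_homo.
rewrite (val_ordS i'j) (val_ordS ije) ltnS ik.
by apply: maxk; apply/asboolP; exists b, i'; rewrite bidx -ej.
Qed.

Lemma join_peak W T : W <= T -> ~ T <= W ->
  exists e, ~ tam_set W e /\ forall U, W `|` U = T -> tam_set U e.
Proof.
move=> /tam_leP WT /exists_peak[e [Te nWe below top]]; exists e; split=> // U WU.
have UT : (tam_set U `<=` tam_set T)%classic by apply/tam_leP; rewrite -WU leUr.
pose S : set (tcomp phi) := [set c | tam_set T c /\ ~ c <= e]%classic.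
have tS : torclosed S.
  split=> [a b ab [Ta nae]|a b c ab bpt cpt cidx [Ta nae] [Tb nbe]].
    by split; [exact: tam_filter Ta | move=> be; apply: nae; exact: le_trans be].
  split; first exact: tam_tor Ta Tb.
  move=> ce; apply: nWe; apply: (tam_filter ce).
  (* Since [a] lies in an earlier component than [e], it is in [W]; were [b] not in [W], [top] would
     put it below [e]. *)
  have be : comp_idx b = comp_idx e by rewrite -cidx; have /comp_leP[] := ce.
  rewrite be in ab; have Wa := below a ab Ta.
  apply: (@tam_tor W a b) => //; first by rewrite be.
  by apply: contrapT => nWb; apply: nbe; exact: top bpt Tb nWb.
apply: contrapT => nUe.
suff [] : S e by move=> _; apply; exact: lexx.
have := Te; rewrite -WU; apply: tam_join_sub => // c.
  by move=> Wc; split; [exact: WT | move=> ce; apply: nWe; exact: tam_filter Wc].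
by move=> Uc; split; [exact: UT | move=> ce; apply: nUe; exact: tam_filter Uc].
Qed.

Lemma tam_join_semidistributive : join_semidistributive (Tam phi).
Proof.
move=> X Y Z XYZ; set W := X `|` (Y `&` Z).
have WT : W <= X `|` Y by rewrite leU2 ?lexx ?leIl.
apply: contrapT => WnT; have nTW : ~ X `|` Y <= W.
  by move=> TW; apply: WnT; apply: le_anti; rewrite WT.
have [e [nWe peak]] := join_peak WT nTW.
have joinW U : X `|` U = X `|` Y -> Y `&` Z <= U -> W `|` U = X `|` Y.
  by move=> <- YZU; rewrite /W -joinA (join_r YZU).
have Ye := peak Y (joinW Y erefl (leIl _ _)).
have Ze := peak Z (joinW Z (esym XYZ) (leIr _ _)).
have /tam_leP YZW : Y `&` Z <= W by exact: leUr.
by apply: nWe; apply: YZW.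
Qed.

(** A step fuses the torclosed rule with up-closure, but only up to [b]. This cap makes [b] lie
    above [c], so that an order filter containing [c] contains [b]. *)
Inductive tor_path (F : set (tcomp phi)) : tcomp phi -> Prop :=
| tor_path_base a : F a -> tor_path F a
| tor_path_step a b c : F a -> (comp_idx a < comp_idx b)%N ->
    comp_pt b = phi (ordS (comp_idx a)) -> tor_path F b ->
    comp_idx c = comp_idx b -> comp_pt a <= comp_pt c <= comp_pt b ->
    tor_path F c.

(** Up-closure: a point above the end of a step is comparable to the chain point used there. If
    below it, the same step reaches it; if above, induction applies to the path to that chain
    point. *)
Lemma tor_path_torclosed (F : set (tcomp phi)) : order_filter F ->
    (forall a (i : 'I_n), (0 < i)%N -> comp_pt a >=< phi i) ->
  torclosed (tor_path F).
Proof.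
move=> filF cmp; split=> [a b ab Fa|a b c ab bpt cpt cidx Fa].
  elim: Fa b ab => [{}a Fa b ab|a' b' c' Fa' ab' bpt' Fb' IH cidx' /andP[ac cb] b].
    by apply: tor_path_base; exact: filF Fa.
  move=> /comp_leP[cb' ptcb]; have: comp_pt b >=< comp_pt b'.
    by rewrite bpt'; apply: cmp; rewrite (val_ordS ab').
  move=> /orP[bb'|b'b].
    apply: (tor_path_step Fa' ab' bpt' Fb'); first by rewrite -cb'.
    by rewrite bb' (le_trans ac).
  by apply: IH; apply/comp_leP; rewrite -cb' cidx'.
move=> Fb; elim: Fa ab bpt c cpt cidx => [{}a Fa|a' b' {}a Fa' ab' bpt' Fb' IH].
  move=> ab bpt c cpt cidx; apply: (tor_path_step Fa ab bpt Fb cidx).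
  by rewrite cpt lexx /= bpt (le_trans (comp_ptP a)) //; exact: chain_le_ordS ab.
move=> cidx' /andP[ac cb] ab bpt c cpt cidx.
(* The path to [a] is moved to the component of [b]: the copy [b''] of [b'] is reached by induction,
   and a step from [a'] through [b''] ends at [c]. *)
have b''P : phi (ordS (comp_idx a')) <= phi (comp_idx b).
  by apply: chain_ordS_le; rewrite -cidx' in ab'; exact: ltn_trans ab.
pose b'' := @TComp d P n phi (_, comp_idx b) b''P.
apply: (@tor_path_step F a' b'' c) => //.
- by rewrite -cidx' in ab'; exact: ltn_trans ab.
- by apply: IH => //; rewrite -cidx'.
- by rewrite cpt ac /= (le_trans cb) // bpt'.
Qed.

Lemma tam_meet_semidistributive :
    (forall a (i : 'I_n), (0 < i)%N -> comp_pt a >=< phi i) ->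
  meet_semidistributive (Tam phi).
Proof.
move=> cmp X Y Z XYZ; apply: le_anti; apply/andP; split; last first.
  by rewrite leI2 ?lexx ?leUl.
have swap c : tam_set X c -> tam_set Z c -> tam_set Y c.
  move=> Xc Zc; have : tam_set (X `&` Z) c by [].
  by rewrite -XYZ => -[].
apply/tam_leP => c [Xc YZc]; split=> //; move: c YZc Xc => c.
pose F := (tam_set Y `|` tam_set Z)%classic.
have filF : order_filter F.
  by move=> a b ab [Ya|Za]; [left|right]; exact: tam_filter ab _.
suff pathY : tor_path F c -> tam_set X c -> tam_set Y c.
  move=> YZc; apply: pathY; move: YZc; apply: tam_join_sub.
  - exact: tor_path_torclosed.
  - by move=> a Ya; apply: tor_path_base; left.
  - by move=> a Za; apply: tor_path_base; right.
elim=> [{}c [//|Zc] Xc|a b {}c Fa ab bpt _ IH cidx /andP[ac cb] Xc].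
  exact: swap.
have Xb : tam_set X b by apply: tam_filter Xc; apply/comp_leP.
have Yb := IH Xb.
have Zb : tam_set Z b.
  by have : tam_set (X `&` Y) b by []; rewrite XYZ => -[].
(* As [b] is in both [Y] and [Z], whichever of them contains [a] also contains its copy [a'] in the
   component of [b]. *)
have a'P : comp_pt a <= phi (comp_idx b).
  by rewrite -cidx (le_trans ac) // comp_ptP.
pose a' := @TComp d P n phi (_, comp_idx b) a'P.
have a'c : a' <= c by apply/comp_leP.
case: Fa => [Ya|Za].
  by apply: (tam_filter a'c); exact: (@tam_tor Y a b).
apply: swap => //; apply: (tam_filter a'c); exact: (@tam_tor Z a b).
Qed.

End Tamari.

Lemma meet_semidistributive_comparable d (P : porderType d) (n : nat)
    (phi : 'I_n.+1 -> P) (m y : P) (k : 'I_n.+1) :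
    (forall i j : 'I_n.+1, (i < j)%N -> phi i < phi j) ->
    (forall x, m <= x) -> y <= phi ord_max -> (0 < k)%N ->
  meet_semidistributive (Tam phi) -> y >=< phi k.
Proof.
move=> hphi mP ymax k0 msd; apply: contrapT => /negP; rewrite negb_or.
move=> /andP[/negP nyk /negP nky].
have kmax : (k < n)%N.
  rewrite ltn_neqAle -ltnS ltn_ord andbT; apply/eqP => kn; apply: nyk.
  by have -> : k = ord_max by exact: val_inj.
pose i := ord_pred k; have Si : ordS i = k by exact: ord_predK.
have ik : (i < k)%N.
  rewrite /i /= -{1}(prednK k0) addSn /= modnDr modn_small ?ltn_predL //.
  exact: leq_ltn_trans (leq_pred k) (ltn_ord k).
pose comp (x : P) (j : 'I_n.+1) (h : x <= phi j) := @TComp d P n.+1 phi (x, j) h.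
(* No component follows the last one, so the torclosed rule is vacuous here. *)
have up_torclosed (x : P) :
    torclosed [set c : tcomp phi | comp_idx c = ord_max /\ x <= comp_pt c]%classic.
  split=> [a b /comp_leP[iab pab] [ia xa]|a b c ab _ _ _ [ia _]].
    by split; [rewrite -iab | exact: le_trans pab].
  by exfalso; move: ab; rewrite ia ltnNge -ltnS ltn_ord.
pose X := MkTam (asboolT (up_torclosed y)).
pose Z := MkTam (asboolT (up_torclosed (phi k))).
(* From component [i] to the last one, the rule would need [phi k] in the last part of the set,
   hence [y <= phi k], which is excluded. *)
have Y_torclosed : torclosed [set c : tcomp phi | comp_idx c = i \/
    [/\ comp_idx c = ord_max, y <= comp_pt c & phi k <= comp_pt c]]%classic.
  split=> [a b /comp_leP[iab pab] [ia|[ia ya ka]]|a b c ab bpt _ _ [ia|[ia _ _]]].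
  - by left; rewrite -iab.
  - by right; split; [rewrite -iab | exact: le_trans pab | exact: le_trans pab].
  - case=> [ib|[_ yb _]]; first by move: ab; rewrite ia ib ltnn.
    by exfalso; apply: nyk; rewrite -Si -ia -bpt.
  - by exfalso; move: ab; rewrite ia ltnNge -ltnS ltn_ord.
pose Y := MkTam (asboolT Y_torclosed).
have imax : i <> ord_max.
  by move=> im; move: ik; rewrite im ltnNge -ltnS ltn_ord.
have XYZ : X `&` Y = X `&` Z.
  apply: tam_eqP => c; rewrite !tam_meetE /=; split=> -[[cm yc]].
    by case=> [ci|[_ _ kc]] //; case: imax; rewrite -ci.
  by case=> _ kc; split=> //; right.
have phikmax : phi k <= phi ord_max by apply: chain_homo => //; exact: ltnW.
pose a := comp m i (mP (phi i)); pose b := comp (phi k) ord_max phikmax.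
pose c := comp m ord_max (mP (phi ord_max)); pose e := comp y ord_max ymax.
have YZY : Y <= Y `|` Z by exact: leUl.
have YZZ : Z <= Y `|` Z by exact: leUr.
have YZa : tam_set (Y `|` Z) a by move/tam_leP: YZY; apply; left.
have YZb : tam_set (Y `|` Z) b by move/tam_leP: YZZ; apply; split=> /=.
have YZc : tam_set (Y `|` Z) c.
  by apply: tam_tor YZa YZb; rewrite //= ?Si // (ltn_trans ik).
have YZe : tam_set (Y `|` Z) e.
  by apply: tam_filter YZc; apply/comp_leP; split=> //; exact: mP.
have : tam_set (X `&` (Y `|` Z)) e by split=> //; split=> /=.
rewrite (msd _ _ _ XYZ) => -[_ [/= /esym //|[_ _ ky]]].
exact: nky.
Qed.

Theorem proposition3p11 (d : Order.disp_t) (P : porderType d)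
    (hfin : forall x : P, finite_set (principal_ideal x))
    (n : nat) (phi : 'I_n.+1 -> P)
    (hphi : forall i j : 'I_n.+1, (i < j)%N -> phi i < phi j) :
  join_semidistributive (Tam phi) /\
  ((exists m : P, forall x : P, m <= x) ->
   (semidistributive (Tam phi) <->
    forall y : P, principal_ideal (phi ord_max) y ->
    forall k : 'I_n.+1, (0 < k)%N -> y >=< phi k)).
Proof.
have jsd := tam_join_semidistributive hphi.
split=> // -[m mP]; split=> [[_ msd] y ymax k k0|cmp].
  exact: meet_semidistributive_comparable msd.
split=> //; apply: tam_meet_semidistributive => // a k k0; apply: cmp => //.
apply: le_trans (comp_ptP a) _; apply: chain_homo => //.
by rewrite -ltnS ltn_ord.
Qed.
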